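(* Let $s \ge 2$ and $n \ge 2$ be integers. Then $$ \tau(n)^{2s-1}\left(\frac{A(2s-1,s-1)}{(2s-1)!}\right)^{\omega(n)} < E_s(n) \le \tau(n)^{2s-1}\left(\frac{1}{2^{2s-1}}\binom{2s}{s}\right)^{\omega(n)}. $$
   Context: $\tau(n)$ is the number of positive divisors of $n$ and $\omega(n)$ is the number of distinct prime divisors of $n$. Write $d(n):=\{d: d \mid n\}$ for the set of positive divisors of $n$. The $s$-th multiplicative energy of $n$ is $$ E_s(n):=\bigl|\{(d_1,\dots,d_{2s}) \in d(n)^{2s}:\ d_1 \cdots d_s = d_{s+1} \cdots d_{2s}\}\bigr|. $$ $A(i,j)$ are the Eulerian numbers of the first kind, $$ A(i,j) = \sum_{v = 0}^{j}\binom{i+1}{v}(-1)^v(j+1-v)^i \quad (0 \le j \le i-1,\ i,j \in \mathbb{Z}). $$ *)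

(* Defs.v *)
From mathcomp Require Import all_boot all_order all_algebra.

Set Implicit Arguments.
Unset Strict Implicit.
Unset Printing Implicit Defensive.

Import Order.TTheory GRing.Theory Num.Theory.

Local Open Scope ring_scope.

Definition tau (n : nat) : nat := size (divisors n).

Definition omega (n : nat) : nat := size (primes n).

(* For n > 0 every divisor of n is at most n, so 'I_n.+1 contains them all.   *)
(* The 2s coordinates are indexed by 'I_(s + s): lshift and rshift give       *)
(* d_1, ..., d_s and d_(s+1), ..., d_(2s) respectively.                       *)
Definition mult_energy (s n : nat) : nat :=
  #|[set d : {ffun 'I_(s + s) -> 'I_n.+1} |
      [forall i, (d i %| n)%N] &&
      (\prod_(i < s) (d (lshift s i) : nat)
         == \prod_(i < s) (d (rshift s i) : nat))%N]|.

(* Meaningful for j <= i - 1. The truncated subtraction is exact as v <= j.   *)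
Definition eulerian (i j : nat) : int :=
  \sum_(0 <= v < j.+1) 'C(i.+1, v)%:Z * (-1) ^+ v * ((j.+1 - v)%N%:Z) ^+ i.

(* Main.v *)
(* Both bounds are multiplicative over coprime factors, so only n = p^(m-1)
   matters. There E_s(n) is the coefficient of x^(s(m-1)) in
   (1 + x + ... + x^(m-1))^(2s), that is
     sum_(v < s) (-1)^v C(2s, v) C((s - v) m + s - 1, 2s - 1).
   The last binomial is an odd polynomial in (s - v) m whose coefficients
   alternate in sign, hence (2s-1)! E_s(n) is an odd polynomial in m. Its
   coefficients are all positive: up to positive factors, they are the numbers
   (-1)^i [x^(s-1)] A_p(x) (1 - x)^(2i), p = 2s - 1 - 2i, with A_p the Eulerian
   polynomial, and A_p is a nonnegative combination of the x^j (1 + x)^(p-1-2j),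
   for which that central coefficient is a super Catalan number. Therefore
   E_s(n) / m^(2s-1) is strictly decreasing in m; its limit is
   A(2s-1, s-1) / (2s-1)! and its value at m = 2 is C(2s, s) / 2^(2s-1). *)
Require Import Defs.
From mathcomp Require Import all_boot all_order all_algebra.
From mathcomp Require Import ring zify.

Set Implicit Arguments.
Unset Strict Implicit.
Unset Printing Implicit Defensive.

Import Order.TTheory GRing.Theory Num.Theory.

Local Open Scope ring_scope.

(** * Central coefficients and gamma-positivity *)

Lemma coef_1DZXn (c : rat) (n k : nat) :
  ((1 + c *: 'X : {poly rat}) ^+ n)`_k = c ^+ k * 'C(n, k)%:R.
Proof.
rewrite exprDn coef_sum.
under eq_bigr => i _ do rewrite expr1n mul1r exprZn coefMn coefZ coefXn.
have [le_kn|lt_nk] := leqP k n.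
  have lt_k : (k < n.+1)%N by [].
  rewrite (bigD1 (Ordinal lt_k)) //= eqxx mulr1 mulr_natr big1 ?addr0 //.
  by move=> i; rewrite -val_eqE /= eq_sym => /negbTE ->; rewrite mulr0 mul0rn.
rewrite bin_small // mulr0 big1 // => i _.
by rewrite gtn_eqF ?mulr0 ?mul0rn // (leq_ltn_trans _ lt_nk) // -ltnS.
Qed.

Lemma coef_1DXn (n k : nat) : ((1 + 'X : {poly rat}) ^+ n)`_k = 'C(n, k)%:R.
Proof. by have := coef_1DZXn 1 n k; rewrite scale1r expr1n mul1r. Qed.

Lemma coef_1BXn (n k : nat) :
  ((1 - 'X : {poly rat}) ^+ n)`_k = (-1) ^+ k * 'C(n, k)%:R.
Proof. by rewrite -scaleN1r coef_1DZXn. Qed.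

(* These are the super Catalan numbers; the identity
   (1 + x)^2 - (1 - x)^2 = 4 x drives the induction. *)
Lemma coef_central (q i : nat) :
  ((1 + 'X : {poly rat}) ^+ (2 * q) * (1 - 'X) ^+ (2 * i))`_(q + i)
    * (q`! * i`! * (q + i)`!)%:R = (-1) ^+ i * ((2 * q)`! * (2 * i)`!)%:R.
Proof.
elim: i q => [|i IHi] q.
  rewrite muln0 addn0 expr0 mulr1 coef_1DXn fact0 !muln1 mul1r -natrM mulnC.
  by rewrite mul2n -addnn -(bin_fact (leq_addr q q)) addnK mulnC.
have -> : ((1 + 'X : {poly rat}) ^+ (2 * q) * (1 - 'X) ^+ (2 * i.+1)) =
    (1 + 'X) ^+ (2 * q.+1) * (1 - 'X) ^+ (2 * i)
    - ((1 + 'X) ^+ (2 * q) * (1 - 'X) ^+ (2 * i)) * 'X *+ 4.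
  by rewrite !mulnS !exprD; ring.
rewrite coefB coefMn coefMX addnS /=.
have := IHi q.+1; have := IHi q; rewrite addSn !mulnS !factS.
move: (_`_(q + i)) (_`_(q + i).+1) => a b; rewrite !natrM exprS.
move: ((-1) ^+ i : rat) => sg.
have := fact_gt0 q; have := fact_gt0 i; have := fact_gt0 (q + i).
rewrite -!(ltr0n rat).
move: (q`!%:R : rat) (i`!%:R : rat) ((q + i)`!%:R : rat)
  (((2 * q)`!)%:R : rat) (((2 * i)`!)%:R : rat) => fq fi fqi f2q f2i h1 h2 h3.
move=> Ha Hb.
(* Scaling by [q.+1] puts both terms in the shape of the induction hypotheses at [q.+1] and at
   [q]. *)
have qi_gt0 : 0 < (q.+1%:R : rat) by rewrite ltr0n.
apply: (mulfI (lt0r_neq0 qi_gt0)).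
rewrite mulrBl mulrBr.
have -> : q.+1%:R * (b * (fq * (i.+1%:R * fi) * ((q + i).+1%:R * fqi))) =
   i.+1%:R * (b * (q.+1%:R * fq * fi * ((q + i).+1%:R * fqi))) by ring.
have -> : q.+1%:R * (a *+ 4 * (fq * (i.+1%:R * fi) * ((q + i).+1%:R * fqi))) =
   4 * q.+1%:R * i.+1%:R * (q + i).+1%:R * (a * (fq * fi * fqi)) by ring.
rewrite Ha Hb.
rewrite -!natr1 ?natrD ?natrM; ring.
Qed.

Lemma coef_central_gt0 (q i : nat) :
  0 < (-1) ^+ i *
    ((1 + 'X : {poly rat}) ^+ (2 * q) * (1 - 'X) ^+ (2 * i))`_(q + i).
Proof.
have f_gt0 : 0 < ((q`! * i`! * (q + i)`!)%:R : rat).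
  by rewrite ltr0n !muln_gt0 !fact_gt0.
rewrite -(pmulr_lgt0 _ f_gt0) -mulrA coef_central mulrA -expr2 sqrr_sign mul1r.
by rewrite ltr0n !muln_gt0 !fact_gt0.
Qed.

(** The index [d] is twice the centre of symmetry. Combinations are nonempty with positive integer
    weights, so strict inequalities pass from the generators to all members. *)
Inductive gamma_pos : nat -> {poly rat} -> Prop :=
| gamma_base j l : gamma_pos (2 * j + l) ('X^j * (1 + 'X) ^+ l)
| gamma_add d f g : gamma_pos d f -> gamma_pos d g -> gamma_pos d (f + g).

Lemma gamma_posMn (d c : nat) (f : {poly rat}) :
  gamma_pos d f -> gamma_pos d (f *+ c.+1).
Proof.
move=> gf; elim: c => [|c IHc]; first by rewrite mulr1n.
by rewrite mulrS; apply: gamma_add.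
Qed.

(* If f is the polynomial of sum_n n^p x^n, that is sum_n n^p x^n =
   x f(x) / (1 - x)^(p+1), then [eulerian_step p f] is that of p+1. *)
Definition eulerian_step (p : nat) (f : {poly rat}) : {poly rat} :=
  (1 + 'X *+ p) * f + 'X * (1 - 'X) * f^`().

(* Index shift: [eulerian_poly d] is the polynomial of sum_n n^(d+1) x^n. *)
Fixpoint eulerian_poly (d : nat) : {poly rat} :=
  if d is d'.+1 then eulerian_step d (eulerian_poly d') else 1.

Lemma mulX_derivXn (j : nat) : 'X * ('X^j)^`() = 'X^j *+ j :> {poly rat}.
Proof.
by case: j => [|j]; rewrite derivXn /= ?mulr0n ?mulr0 // exprS mulrnAr.
Qed.

(** The step sends x^j (1 + x)^l to (j + 1) x^j (1 + x)^(l+1) + 2l x^(j+1) (1 + x)^(l-1); the second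
    term is absent for l = 0. *)
Lemma gamma_pos_step (d : nat) (f : {poly rat}) :
  gamma_pos d f -> gamma_pos d.+1 (eulerian_step d.+1 f).
Proof.
elim=> {d f} [j l | d f g _ IHf _ IHg]; last first.
  suff -> : eulerian_step d.+1 (f + g) =
      eulerian_step d.+1 f + eulerian_step d.+1 g by apply: gamma_add.
  by rewrite /eulerian_step derivD; ring.
rewrite /eulerian_step derivM; case: l => [|l].
  rewrite expr0 derivC mulr0 addr0 !mulr1 mulrAC mulX_derivXn addn0.
  suff -> : (1 + 'X *+ (2 * j).+1) * 'X^j + 'X^j *+ j * (1 - 'X) =
      ('X^j * (1 + 'X) ^+ 1) *+ j.+1 :> {poly rat}.
    by rewrite -addn1; apply/gamma_posMn/gamma_base.
  ring.
have -> : 'X * (1 - 'X : {poly rat}) * (('X^j)^`() * (1 + 'X) ^+ l.+1 +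
    'X^j * ((1 + 'X) ^+ l.+1)^`()) =
    (1 - 'X) * ('X^j *+ j) * (1 + 'X) ^+ l.+1 +
    'X^(j.+1) * (1 - 'X) * ((1 + 'X) ^+ l *+ l.+1).
  rewrite -mulX_derivXn (deriv_exp (1 + 'X)) derivD derivC derivX !exprS /=.
  ring.
suff -> : (1 + 'X *+ (2 * j + l.+1).+1 : {poly rat}) *
      ('X^j * (1 + 'X) ^+ l.+1) +
    ((1 - 'X) * ('X^j *+ j) * (1 + 'X) ^+ l.+1 +
     'X^(j.+1) * (1 - 'X) * ((1 + 'X) ^+ l *+ l.+1)) =
    ('X^j * (1 + 'X) ^+ l.+2) *+ j.+1 +
    ('X^(j.+1) * (1 + 'X) ^+ l) *+ (2 * l).+2.
  apply: gamma_add; apply: gamma_posMn.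
    by rewrite -addnS; apply: gamma_base.
  have -> : (2 * j + l.+1).+1 = (2 * j.+1 + l)%N by lia.
  exact: gamma_base.
rewrite !exprS; ring.
Qed.

Lemma gamma_pos_eulerian_poly (d : nat) : gamma_pos d (eulerian_poly d).
Proof.
elim: d => [|d IHd]; last exact: gamma_pos_step.
by have := gamma_base 0 0; rewrite expr0 expr0 mulr1.
Qed.

Lemma gamma_pos_coef (r i : nat) (f : {poly rat}) :
  gamma_pos (2 * r) f ->
  0 < (-1) ^+ i * (f * (1 - 'X) ^+ (2 * i))`_(r + i).
Proof.
move: {2}(2 * r)%N (erefl (2 * r)%N) => d dE; rewrite dE => gf.
elim: gf dE => {d f} [j l | d f g _ IHf _ IHg] dE; last first.
  by rewrite mulrDl coefD mulrDr addr_gt0 ?IHf ?IHg.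
have -> : l = (2 * (r - j))%N by lia.
rewrite -mulrA coefXnM ifF; last by lia.
have -> : (r + i - j = r - j + i)%N by lia.
exact: coef_central_gt0.
Qed.

(** * Truncated power series *)

(** Series identities are stated modulo x^N, with an explicit multiple of x^N as remainder. Since
    0^0 = 1, the case p = 0 is the geometric series. *)
Definition power_series (N p : nat) : {poly rat} := \poly_(n < N) (n ^ p)%:R.

Lemma mul_1BX_geom (N : nat) :
  (1 - 'X) * (\sum_(k < N) 'X^k) = 1 - 'X^N :> {poly rat}.
Proof.
by rewrite -[in RHS](expr1n _ N) subrXX; congr (_ * _); apply: eq_bigr => i _;
  rewrite expr1n mul1r.
Qed.

Lemma power_seriesS (N p : nat) :
  power_series N p.+1 = 'X * (power_series N p)^`().
Proof.
apply/polyP => -[|k]; rewrite coefXM coef_poly /=.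
  by rewrite exp0n // if_same.
rewrite coef_deriv coef_poly; case: ifP => _; last by rewrite mul0rn.
by rewrite expnS natrM mulr_natl.
Qed.

(** Apply x (1 - x) d/dx to the hypothesis: the factor x keeps the derivative of x^N r a multiple of
    x^N. *)
Lemma power_series_step (N p : nat) (f r : {poly rat}) :
  (1 - 'X) ^+ p.+1 * power_series N p = f + 'X^N * r ->
  exists r', (1 - 'X) ^+ p.+2 * power_series N p.+1 =
    'X * (1 - 'X) * f^`() + 'X * f *+ p.+1 + 'X^N * r'.
Proof.
move=> def_f.
have := congr1 (fun g => 'X * (1 - 'X) * g^`()) def_f.
rewrite derivM derivD derivM (deriv_exp (1 - 'X)) derivB derivC derivX /=.
rewrite power_seriesS => def_f'.
exists ((1 - 'X) * (r *+ N + 'X * r^`()) + 'X * r *+ p.+1).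
have -> : (1 - 'X) ^+ p.+2 * ('X * (power_series N p)^`()) =
    'X * (1 - 'X) * ((0 - 1) * (1 - 'X) ^+ p *+ p.+1 * power_series N p
       + (1 - 'X) ^+ p.+1 * (power_series N p)^`())
    + 'X * ((1 - 'X) ^+ p.+1 * power_series N p) *+ p.+1.
  by rewrite !exprS; ring.
rewrite def_f' def_f.
have -> : 'X * (1 - 'X) * (f^`() + (('X^N)^`() * r + 'X^N * r^`())) =
    'X * (1 - 'X) * f^`() +
    (1 - 'X) * (('X * ('X^N)^`()) * r + 'X * 'X^N * r^`()).
  by ring.
by rewrite mulX_derivXn; ring.
Qed.

(** For a numerator of the form x f, the recursion of [power_series_step] becomes [eulerian_step] on
    f. *)
Lemma power_series_eulerian (N d : nat) :
  exists r, (1 - 'X) ^+ d.+2 * power_series N d.+1 =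
    'X * eulerian_poly d + 'X^N * r.
Proof.
elim: d => [|d [r IHd]].
  have [|r ->] := @power_series_step N 0 1 (- 1).
    rewrite expr1 mulrN mulr1 -mul_1BX_geom; congr (_ * _).
    by rewrite /power_series poly_def; apply: eq_bigr => i _; rewrite scale1r.
  by exists r; rewrite derivC mulr0 add0r.
have [r' ->] := power_series_step IHd; exists r'; congr (_ + _).
by rewrite /= /eulerian_step derivM derivX; ring.
Qed.

(** This is 1 / (1 - x)^(k+1) modulo x^N; multiplying by one factor 1 - x is Pascal's rule. *)
Lemma binomial_series (N k : nat) :
  exists r, (1 - 'X) ^+ k.+1 * (\poly_(n < N) 'C(n + k, k)%:R : {poly rat}) =
    1 + 'X^N * r.
Proof.
elim: k => [|k [r IHk]].
  exists (- 1); rewrite expr1 mulrN mulr1 -mul_1BX_geom; congr (_ * _).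
  by rewrite poly_def; apply: eq_bigr => i _; rewrite addn0 bin0 scale1r.
(* The correction comes from the last coefficient before truncation, which 1 - x pushes to degree
   N. *)
exists (r - (1 - 'X) ^+ k.+1 * 'C(N + k, k.+1)%:R%:P).
rewrite exprSr -mulrA.
have -> : (1 - 'X) * (\poly_(n < N) 'C(n + k.+1, k.+1)%:R : {poly rat}) =
    \poly_(n < N) 'C(n + k, k)%:R - 'X^N * 'C(N + k, k.+1)%:R%:P.
  apply/polyP => n; rewrite mulrBl mul1r !coefB coefXM coefXnM !coef_poly coefC.
  case: n => [|n] /=.
    by case: N {IHk} => [|N] /=; rewrite ?addn0 ?subr0 ?add0n ?binn ?bin_small.
  rewrite subn_eq0; have [lt_nN|lt_Nn|def_N] := ltngtP n.+1 N.
  - by rewrite addnS binS addSnnS natrD; ring.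
  - by [].
  - by rewrite -def_N addSnnS.
rewrite mulrBr IHk; ring.
Qed.

(** Up to the factor [central_factorial s i], this is the coefficient of m^(2(s-i)+1) in the
    rescaled prime power energy. From here on [s.+1] stands for the s of the theorem. *)
Definition alternating_power_sum (s i : nat) : rat :=
  (-1) ^+ i * \sum_(v < s.+1)
    (-1) ^+ v * 'C(2 * s.+1, v)%:R * ((s.+1 - v) ^ (2 * (s - i)).+1)%:R.

(* The alternating sum is the central coefficient of (1 - x)^(2s) times the
   series of k^p, that is of (1 - x)^(2i) times an Eulerian polynomial. *)
Lemma alternating_power_sum_gt0 (s i : nat) :
  (i <= s)%N -> 0 < alternating_power_sum s i.
Proof.
move=> le_is; rewrite /alternating_power_sum.
have [r def_r] := power_series_eulerian s.+2 (2 * (s - i)).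
have := gamma_pos_coef i (gamma_pos_eulerian_poly (2 * (s - i))).
rewrite subnK //; congr (_ < _ * _).
transitivity (((1 - 'X) ^+ (2 * s.+1) *
    power_series s.+2 (2 * (s - i)).+1)`_s.+1).
  have -> : (2 * s.+1 = 2 * i + (2 * (s - i)).+2)%N by lia.
  rewrite exprD -mulrA def_r mulrDr coefD mulrCA coefXM /= mulrC.
  by rewrite mulrCA coefXnM ltnSn addr0.
(* The extra term v = s + 1 carries a positive power of 0. *)
rewrite coefM big_ord_recr /= subnn [in X in _ + X]coef_poly exp0n //=.
rewrite mulr0 addr0.
apply: eq_bigr => v _.
by rewrite coef_1BXn coef_poly ltnS leq_subr.
Qed.

Lemma coef_signM (v k : nat) (f : {poly rat}) :
  ((-1) ^+ v * f)`_k = (-1) ^+ v * f`_k.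
Proof.
by rewrite -[(-1) ^+ v]signr_odd -[in RHS]signr_odd; case: odd;
  rewrite ?expr1 ?expr0 ?mulN1r ?mul1r ?coefN.
Qed.

(** Write the geometric sum as (1 - x^m) / (1 - x), expand the numerator by the binomial theorem and
    the denominator by [binomial_series]. *)
Lemma coef_central_geom (s m : nat) : (0 < m)%N ->
  ((\sum_(k < m) 'X^k : {poly rat}) ^+ (2 * s.+1))`_(s.+1 * m.-1) =
  \sum_(v < s.+1) (-1) ^+ v * 'C(2 * s.+1, v)%:R
     * 'C((s.+1 - v) * m + s, (2 * s).+1)%:R.
Proof.
move=> m_gt0; set G := \sum_(k < m) _.
have [r def_r] := binomial_series (s.+1 * m) (2 * s).+1.
have lt_c : (s.+1 * m.-1 < s.+1 * m)%N by rewrite ltn_pmul2l // prednK.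
have def_s2 : (2 * s.+1 = (2 * s).+2)%N by lia.
have -> : G ^+ (2 * s.+1) = (1 - 'X^m) ^+ (2 * s.+1) *
    (\poly_(n < s.+1 * m) 'C(n + (2 * s).+1, (2 * s).+1)%:R)
    - 'X^(s.+1 * m) * (G ^+ (2 * s.+1) * r).
  rewrite -mul_1BX_geom exprMn def_s2 mulrAC def_r.
  by rewrite -/G; ring.
rewrite coefB coefXnM lt_c subr0 exprBn mulr_suml coef_sum.
(* Terms with v > s start at degree mv >= (s+1)m, above the coefficient read. *)
have -> : (2 * s.+1).+1 = (s.+1 + s.+2)%N by lia.
rewrite big_split_ord /= [X in _ + X]big1 ?addr0 => [|v _]; last first.
  rewrite expr1n mulr1 -exprM mulrnAl coefMn -mulrA.
  rewrite coef_signM coefXnM ifT ?mulr0 ?mul0rn //.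
  by nia.
apply: eq_bigr => v _.
rewrite expr1n mulr1 -exprM mulrnAl coefMn -[in LHS]mulrA.
rewrite coef_signM coefXnM coef_poly.
have def_m : ((s.+1 - v) * m + m * v = s.+1 * m.-1 + s.+1)%N.
  rewrite (mulnC m) -mulnDl subnK ?(ltnW (ltn_ord v)) // addnC.
  by rewrite -[in LHS](prednK m_gt0) mulnS.
move: ((s.+1 - v) * m)%N (m * v)%N (s.+1 * m.-1)%N def_m lt_c.
move=> a b c def_m lt_c.
(* If mv exceeds the target degree, then (s+1-v)m <= s, and the binomial on the right vanishes
   too. *)
case: ltnP => [lt_cv | le_vc].
  by rewrite mulr0 mul0rn [X in _ = _ * X%:R]bin_small ?mulr0 //; lia.
rewrite ifT; last by lia.
rewrite -mulrA mulr_natl mulrnAr; congr ((_ * ('C(_, _))%:R) *+ _).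
by lia.
Qed.

(** * The prime power case as a polynomial in the exponent *)

(* Elementary symmetric functions of 1^2, ..., s^2. *)
Fixpoint central_factorial (s i : nat) : nat :=
  match s, i with
  | s'.+1, i'.+1 =>
      central_factorial s' i + s ^ 2 * central_factorial s' i'
  | _, 0 => 1
  | 0, _ => 0
  end.

Lemma central_factorial0 (s : nat) : central_factorial s 0 = 1%N.
Proof. by case: s. Qed.

Lemma central_factorial_gt0 (s i : nat) :
  (i <= s)%N -> (0 < central_factorial s i)%N.
Proof.
elim: s i => [|s IHs] [|i] //= le_is.
by rewrite addn_gt0 orbC muln_gt0 IHs.
Qed.

Lemma central_factorial_small (s i : nat) :
  (s < i)%N -> central_factorial s i = 0%N.
Proof.
elim: s i => [|s IHs] [|i] //= lt_si.
by rewrite !IHs ?muln0 // ltnW.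
Qed.

(** The falling factorial is centred at t, hence equals t times the product of the t^2 - k^2 for 1
    <= k <= s. *)
Lemma ffact_central_factorial (s t : nat) :
  ((t + s) ^_ (2 * s).+1)%:R = \sum_(i < s.+1)
    (-1) ^+ i * (central_factorial s i)%:R * t%:R ^+ (2 * (s - i)).+1 :> rat.
Proof.
elim: s => [|s IHs].
  by rewrite big_ord_recl big_ord0 /= addn0 ffactn1 addr0 !mul1r expr1.
have -> : ((t + s.+1) ^_ (2 * s.+1).+1)%:R =
    ((t + s) ^_ (2 * s).+1)%:R * (t%:R ^+ 2 - (s.+1 ^ 2)%:R) :> rat.
  have -> : ((2 * s.+1).+1 = (2 * s).+3)%N by lia.
  rewrite addnS ffactSS ffactnSr.
  (* For t <= s both sides vanish; otherwise the natural subtraction is exact. *)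
  have [le_ts|lt_st] := leqP t s.
    by rewrite ffact_small ?mul0n ?muln0 ?mul0r //; lia.
  have -> : (t + s - (2 * s).+1 = t - s.+1)%N by lia.
  by rewrite natrM [in LHS]natrM natrB // natrM; ring.
rewrite IHs mulrBr mulr_suml.
pose g i : rat := (-1) ^+ i * (central_factorial s i)%:R
  * t%:R ^+ (2 * (s - i)).+1 * t%:R ^+ 2.
(* A vanishing term i = s + 1 is appended to match the range of the goal. *)
have -> : \sum_(i < s.+1) (-1) ^+ i * (central_factorial s i)%:R
    * t%:R ^+ (2 * (s - i)).+1 * t%:R ^+ 2 = \sum_(i < s.+2) g i.
  rewrite [RHS]big_ord_recr /= [g s.+1]/g central_factorial_small //.
  by rewrite mulr0 !mul0r addr0.
rewrite big_ord_recl [RHS]big_ord_recl -addrA; congr (_ + _).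
  rewrite /g !central_factorial0 -mulrA -exprD !subn0; congr (_ * _ ^+ _).
  by rewrite -/(central_factorial s.+1 0) ?central_factorial0; lia.
rewrite mulr_suml -sumrB; apply: eq_bigr => i _.
rewrite lift0 subSS /g /= natrD natrM exprS.
have [lt_is|] := ltnP i s.
  have -> : (2 * (s - i)).+1 = ((2 * (s - i.+1)).+1 + 2)%N by lia.
  by rewrite exprD; ring.
move=> le_si; rewrite (@central_factorial_small s i.+1) //; ring.
Qed.

(** After multiplication by (2s+1)! each binomial is a falling factorial centred at (s+1-v)m;
    expanding it and exchanging the sums collects the powers of m. *)
Lemma central_geom_expansion (s m : nat) : (0 < m)%N ->
  ((\sum_(k < m) 'X^k : {poly rat}) ^+ (2 * s.+1))`_(s.+1 * m.-1)
    * ((2 * s).+1)`!%:R =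
  \sum_(i < s.+1) (central_factorial s i)%:R * alternating_power_sum s i
    * m%:R ^+ (2 * (s - i)).+1.
Proof.
move=> m_gt0; rewrite coef_central_geom // mulr_suml.
transitivity (\sum_(v < s.+1) \sum_(i < s.+1)
    (-1) ^+ v * 'C(2 * s.+1, v)%:R * ((-1) ^+ i * (central_factorial s i)%:R *
      ((s.+1 - v) * m)%:R ^+ (2 * (s - i)).+1) : rat).
  apply: eq_bigr => v _.
  by rewrite -[LHS]mulrA -natrM bin_ffact ffact_central_factorial mulr_sumr.
rewrite exchange_big /=; apply: eq_bigr => i _.
rewrite /alternating_power_sum mulr_sumr mulr_sumr mulr_suml.
by apply: eq_bigr => v _; rewrite natrM exprMn natrX; ring.
Qed.

Lemma alternating_power_sum_eulerian (s : nat) :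
  alternating_power_sum s 0 = (eulerian (2 * s).+1 s)%:~R.
Proof.
rewrite /alternating_power_sum /eulerian expr0 mul1r big_mkord rmorph_sum /=.
apply: eq_bigr => v _; rewrite subn0 natrX !rmorphM !rmorphXn rmorphN1 /=.
by rewrite mulnS [((-1) ^+ v * _)]mulrC.
Qed.

Lemma eulerian_gt0 (s : nat) : 0 < ((eulerian (2 * s).+1 s)%:~R : rat).
Proof.
by rewrite -alternating_power_sum_eulerian alternating_power_sum_gt0.
Qed.

(** The bound is the leading term i = 0 of the expansion; all other terms are positive, and [0 < s]
    provides at least the one for i = 1. *)
Lemma central_geom_gt (s m : nat) : (0 < m)%N -> (0 < s)%N ->
  m%:R ^+ (2 * s).+1 * ((eulerian (2 * s).+1 s)%:~R / ((2 * s).+1)`!%:R) <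
  ((\sum_(k < m) 'X^k : {poly rat}) ^+ (2 * s.+1))`_(s.+1 * m.-1).
Proof.
move=> m_gt0 s_gt0.
rewrite mulrA ltr_pdivrMr ?ltr0n ?fact_gt0 // central_geom_expansion //.
rewrite big_ord_recl /= subn0 central_factorial0 mul1r.
rewrite alternating_power_sum_eulerian mulrC ltrDl.
case: s s_gt0 => // s _; rewrite big_ord_recl ltr_pwDl //.
  rewrite mulr_gt0 ?exprn_gt0 ?ltr0n //.
  rewrite mulr_gt0 ?ltr0n ?central_factorial_gt0 //.
  by rewrite alternating_power_sum_gt0.
apply: sumr_ge0 => i _; rewrite mulr_ge0 ?exprn_ge0 // mulr_ge0 //.
by apply/ltW/alternating_power_sum_gt0; rewrite ltn_ord.
Qed.

(** The central binomial is the same coefficient at m = 2. The two expansions compare term by term,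
    through 2^(2i) <= m^(2i). *)
Lemma central_geom_le (s m : nat) : (1 < m)%N ->
  ((\sum_(k < m) 'X^k : {poly rat}) ^+ (2 * s.+1))`_(s.+1 * m.-1) <=
  m%:R ^+ (2 * s).+1 * ('C(2 * s.+1, s.+1)%:R / 2 ^+ (2 * s).+1).
Proof.
move=> m_gt1.
have -> : 'C(2 * s.+1, s.+1)%:R =
    ((\sum_(k < 2) 'X^k : {poly rat}) ^+ (2 * s.+1))`_(s.+1 * 2.-1).
  by rewrite !big_ord_recl big_ord0 addr0 muln1 coef_1DXn.
have f_gt0 : 0 < (((2 * s).+1)`!%:R : rat) by rewrite ltr0n fact_gt0.
rewrite mulrA ler_pdivlMr ?exprn_gt0 // -(ler_pM2r f_gt0).
rewrite mulrAC central_geom_expansion ?(ltnW m_gt1) //.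
rewrite -mulrA central_geom_expansion // mulr_suml mulr_sumr.
apply: ler_sum => i _.
have := alternating_power_sum_gt0 (ltn_ord i : (i <= s)%N).
move: (alternating_power_sum s i) => w w_gt0.
have c_ge0 : 0 <= ((central_factorial s i)%:R : rat) by [].
have -> : (2 * s).+1 = ((2 * (s - i)).+1 + 2 * i)%N by have := ltn_ord i; lia.
move: (2 * (s - i)).+1 (central_factorial s i)%:R c_ge0 => e c c_ge0.
rewrite (exprD _ e) (exprD m%:R e).
have le_2m : 2 ^+ (2 * i) <= m%:R ^+ (2 * i) :> rat.
  by rewrite lerXn2r ?nnegrE // ler_nat.
move: (2 ^+ (2 * i)) (m%:R ^+ (2 * i)) le_2m => x y le_xy.
have := exprn_ge0 e (ler0n rat m); have := exprn_ge0 e (ler0n rat 2).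
move: (2 ^+ e) (m%:R ^+ e) => a b a_ge0 b_ge0.
have -> : c * w * b * (a * x) = c * w * b * a * x by ring.
have -> : b * y * (c * w * a) = c * w * b * a * y by ring.
by rewrite ler_wpM2l // mulr_ge0 // mulr_ge0 // mulr_ge0 // ltW.
Qed.

(** * Multiplicativity of the energy *)

Lemma prod_expn (I : finType) (p : nat) (e : I -> nat) :
  (\prod_i p ^ e i = p ^ \sum_i e i)%N.
Proof. by rewrite (big_morph _ (expnD p) (expn0 p)). Qed.

Lemma mult_energy_pfactor (s p a : nat) : prime p ->
  mult_energy s (p ^ a) =
  #|[set f : {ffun 'I_(s + s) -> 'I_a.+1} |
      (\sum_(i < s) f (lshift s i) == \sum_(i < s) f (rshift s i))%N]|.
Proof.
move=> p_pr; have p_gt1 := prime_gt1 p_pr; set E := [set f | _].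
pose F (f : {ffun 'I_(s + s) -> 'I_a.+1}) :
  {ffun 'I_(s + s) -> 'I_(p ^ a).+1} := [ffun i => inord (p ^ f i)].
have valF f i : F f i = (p ^ f i)%N :> nat.
  by rewrite ffunE inordK // ltnS leq_exp2l // -ltnS.
rewrite -(@card_in_imset _ _ F (mem E)) => [|f g _ _ eqFfg]; last first.
  apply/ffunP => i; apply/val_inj/eqP; rewrite /= -(eqn_exp2l _ _ p_gt1).
  by rewrite -!valF eqFfg.
congr #|pred_of_set _|; apply/setP => d; rewrite inE.
apply/andP/imsetP => [[/forallP d_dvd /eqP d_eq] | [f]]; last first.
  rewrite inE => /eqP f_eq ->; split.
    by apply/forallP => i; rewrite valF dvdn_exp2l // -ltnS.
  under eq_bigr do rewrite valF.
  by under [X in _ == X]eq_bigr do rewrite valF; rewrite !prod_expn f_eq.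
have d_pow i : d i = (p ^ logn p (d i))%N :> nat.
  by have /(dvdn_pfactor _ _ p_pr)[k _ ->] := d_dvd i; rewrite pfactorK.
have log_le i : (logn p (d i) < a.+1)%N.
  have /(dvdn_pfactor _ _ p_pr)[k le_ka ->] := d_dvd i.
  by rewrite pfactorK.
exists [ffun i => inord (logn p (d i))]; last first.
  by apply/ffunP => i; apply/val_inj; rewrite /= valF ffunE inordK.
rewrite inE -(eqn_exp2l _ _ p_gt1) -!prod_expn; apply/eqP.
transitivity (\prod_(i < s) (d (lshift s i) : nat))%N.
  by apply: eq_bigr => i _; rewrite ffunE inordK // -d_pow.
by rewrite d_eq; apply: eq_bigr => i _; rewrite ffunE inordK // -d_pow.
Qed.

(* The second half of the exponents is reflected, e |-> a - e, which turns the
   balance condition into a prescribed value of the total sum. *)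
Lemma mult_energy_coef (s p a : nat) : prime p ->
  (mult_energy s (p ^ a))%:R =
  ((\sum_(k < a.+1) 'X^k : {poly rat}) ^+ (2 * s))`_(s * a).
Proof.
move=> p_pr; rewrite mult_energy_pfactor //.
pose h (i : 'I_(s + s)) (k : 'I_a.+1) : nat :=
  if split i is inl _ then k else (a - k)%N.
have hl i k : h (lshift s i) k = k.
  by rewrite /h; case: split_ordP => j // /eqP; rewrite eq_lrshift.
have hr i k : h (rshift s i) k = (a - k)%N.
  by rewrite /h; case: split_ordP => j // /eqP; rewrite eq_rlshift.
have -> : (\sum_(k < a.+1) 'X^k : {poly rat}) ^+ (2 * s) =
    \prod_(i < s + s) \sum_(k < a.+1) 'X^(h i k).
  rewrite big_split_ord /= mul2n -addnn exprD; congr (_ * _).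
    rewrite -[in LHS](card_ord s) -prodr_const; apply: eq_bigr => i _.
    by apply: eq_bigr => k _; rewrite hl.
  rewrite -[in LHS](card_ord s) -prodr_const; apply: eq_bigr => i _.
  rewrite (reindex_inj rev_ord_inj); apply: eq_bigr => k _ /=.
  by rewrite hr subSS.
(* Expanding the product gives one monomial per exponent tuple [f], which counts exactly when its
   degree is [s * a]. *)
rewrite bigA_distr_bigA coef_sum -sum1_card natr_sum big_mkcond /=.
apply: eq_bigr => f _; rewrite inE.
rewrite -(big_morph _ (exprD 'X) (expr0 'X)) coefXn big_split_ord /=.
under [X in (_ == (X + _)%N)%:R]eq_bigr do rewrite hl.
under [X in (_ == (_ + X)%N)%:R]eq_bigr do rewrite hr.
have : (\sum_(i < s) (a - f (rshift s i)) + \sum_(i < s) f (rshift s i) =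
    s * a)%N.
  rewrite -big_split /= -[in RHS](card_ord s) -sum_nat_const.
  by apply: eq_bigr => i _; rewrite subnK // -ltnS.
move: (\sum_(i < s) f (lshift s i))%N (\sum_(i < s) f (rshift s i))%N => x y.
move: (\sum_(i < s) _)%N => z def_sa.
by rewrite -def_sa addnC eqn_add2r eq_sym; case: eqP.
Qed.

Lemma gcdn_coprimeM (a b x y : nat) :
  coprime a b -> (x %| a)%N -> (y %| b)%N -> gcdn a (x * y) = x.
Proof.
move=> co_ab x_a y_b; rewrite Gauss_gcdl ?(coprime_dvdr y_b) //.
exact/gcdn_idPr.
Qed.

Lemma gcdn_coprime_split (a b d : nat) :
  coprime a b -> (d %| a * b)%N -> d = (gcdn a d * gcdn b d)%N.
Proof.
move=> co_ab d_ab; apply/eqP; rewrite eqn_dvd; apply/andP; split.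
  rewrite muln_gcdl !muln_gcdr !dvdn_gcd d_ab.
  by rewrite (dvdn_mull _ (dvdnn d)) !(dvdn_mulr _ (dvdnn d)).
rewrite Gauss_dvd ?dvdn_gcdr // (coprime_dvdl (dvdn_gcdl a d)) //.
by rewrite (coprime_dvdr (dvdn_gcdl b d)).
Qed.

(** Multiplying coordinates is a bijection from pairs of tuples, with inverse d -> (gcd(a, d),
    gcd(b, d)). *)
Lemma mult_energyM (s a b : nat) : (0 < a)%N -> (0 < b)%N -> coprime a b ->
  mult_energy s (a * b) = (mult_energy s a * mult_energy s b)%N.
Proof.
move=> a_gt0 b_gt0 co_ab; rewrite {2 3}/mult_energy -cardsX.
set E := setX _ _.
pose F (u : {ffun 'I_(s + s) -> 'I_a.+1} * {ffun 'I_(s + s) -> 'I_b.+1}) :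
    {ffun 'I_(s + s) -> 'I_(a * b).+1} := [ffun i => inord (u.1 i * u.2 i)].
have valF u i : F u i = (u.1 i * u.2 i)%N :> nat.
  by rewrite ffunE inordK // ltnS leq_mul // -ltnS.
have co_ba : coprime b a by rewrite coprime_sym.
rewrite -(@card_in_imset _ _ F (mem E)) => [|[u1 u2] [v1 v2] /=]; last first.
  rewrite !inE /= => /andP[/andP[/forallP u1a _] /andP[/forallP u2b _]].
  move=> /andP[/andP[/forallP v1a _] /andP[/forallP v2b _]] eqF.
  have eq_uv i : (u1 i * u2 i = v1 i * v2 i)%N.
    by have := valF (u1, u2) i; rewrite eqF valF.
  congr (_, _); apply/ffunP => i; apply/val_inj => /=.
    rewrite -(gcdn_coprimeM co_ab (u1a i) (u2b i)) eq_uv.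
    exact: gcdn_coprimeM co_ab (v1a i) (v2b i).
  rewrite -(gcdn_coprimeM co_ba (u2b i) (u1a i)) mulnC eq_uv mulnC.
  exact: gcdn_coprimeM co_ba (v2b i) (v1a i).
congr #|pred_of_set _|; apply/setP => d; rewrite inE.
apply/andP/imsetP => [[/forallP d_dvd /eqP d_eq] | [[u v]]]; last first.
  rewrite !inE /= => /andP[/andP[/forallP ua /eqP u_eq]].
  move=> /andP[/forallP vb /eqP v_eq].
  move=> ->; split; first by apply/forallP => i; rewrite valF dvdn_mul.
  under eq_bigr do rewrite valF.
  under [X in _ == X]eq_bigr do rewrite valF.
  by rewrite !big_split /= u_eq v_eq.
have gcd_le n i : (0 < n)%N -> (gcdn n (d i) < n.+1)%N.
  by move=> n_gt0; rewrite ltnS dvdn_leq ?dvdn_gcdl.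
have d_gcd i : d i = (gcdn a (d i) * gcdn b (d i))%N :> nat.
  exact: gcdn_coprime_split.
have dvd_prod n (j : 'I_s -> 'I_(s + s)) :
    (\prod_(i < s) gcdn n (d (j i)) %| n ^ s)%N.
  rewrite -[in X in (_ %| X)%N](card_ord s) -prod_nat_const.
  by apply: (big_ind2 dvdn) => // *; rewrite ?dvdn_mul // dvdn_gcdl.
(* The two parts of each product divide the coprime numbers n^s and m^s, so a gcd with n^s extracts
   the n-part of the balance equation. *)
have prod_eq n m : coprime n m ->
    (forall i, d i = gcdn n (d i) * gcdn m (d i) :> nat)%N ->
    (\prod_(i < s) gcdn n (d (lshift s i)) =
     \prod_(i < s) gcdn n (d (rshift s i)))%N.
  move=> co_nm def_d.
  have co_nms : coprime (n ^ s) (m ^ s) by rewrite coprimeXl ?coprimeXr.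
  rewrite -(gcdn_coprimeM co_nms (dvd_prod n (lshift s))
    (dvd_prod m (lshift s))).
  rewrite -(gcdn_coprimeM co_nms (dvd_prod n (@rshift s s))
    (dvd_prod m (@rshift s s))).
  rewrite -!big_split /=; congr (gcdn _ _).
  transitivity (\prod_(i < s) (d (lshift s i) : nat))%N.
    by apply: eq_bigr => i _; rewrite -def_d.
  by rewrite d_eq; apply: eq_bigr => i _; rewrite -def_d.
exists ([ffun i => inord (gcdn a (d i))], [ffun i => inord (gcdn b (d i))]).
  rewrite !inE /=; apply/andP; split; apply/andP; split.
  - by apply/forallP => i; rewrite ffunE inordK ?dvdn_gcdl ?gcd_le.
  - under eq_bigr do rewrite ffunE inordK ?gcd_le //.
    under [X in _ == X]eq_bigr do rewrite ffunE inordK ?gcd_le //.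
    by rewrite (prod_eq a b).
  - by apply/forallP => i; rewrite ffunE inordK ?dvdn_gcdl ?gcd_le.
  - under eq_bigr do rewrite ffunE inordK ?gcd_le //.
    under [X in _ == X]eq_bigr do rewrite ffunE inordK ?gcd_le //.
    by rewrite (prod_eq b a) // => i; rewrite [RHS]mulnC.
by apply/ffunP => i; apply/val_inj; rewrite /= valF !ffunE !inordK ?gcd_le.
Qed.

(** * Multiplicativity of [tau] and additivity of [omega] *)

Lemma tauM (a b : nat) : (0 < a)%N -> (0 < b)%N -> coprime a b ->
  tau (a * b) = (tau a * tau b)%N.
Proof.
move=> a_gt0 b_gt0 co_ab; rewrite /tau -(size_allpairs muln).
apply/perm_size/uniq_perm; rewrite ?divisors_uniq //.
  apply: allpairs_uniq; rewrite ?divisors_uniq // => -[x y] [x' y'].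
  move=> /allpairsP[[u v] /= [ua vb [-> ->]]].
  move=> /allpairsP[[u' v'] /= [ua' vb' [-> ->]]].
  rewrite -!dvdn_divisors // in ua vb ua' vb'.
  move=> eq_uv; congr (_, _).
    by rewrite -(gcdn_coprimeM co_ab ua vb) eq_uv (gcdn_coprimeM co_ab ua' vb').
  have co_ba : coprime b a by rewrite coprime_sym.
  rewrite -(gcdn_coprimeM co_ba vb ua) mulnC eq_uv mulnC.
  exact: gcdn_coprimeM co_ba vb' ua'.
move=> d; rewrite -dvdn_divisors ?muln_gt0 ?a_gt0 //.
apply/idP/allpairsP => [d_ab | [[x y] /= [xa yb ->]]]; last first.
  by rewrite -!dvdn_divisors // in xa yb; rewrite dvdn_mul.
exists (gcdn a d, gcdn b d); rewrite -!dvdn_divisors // !dvdn_gcdl.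
by split=> //; apply: gcdn_coprime_split.
Qed.

Lemma tau_pfactor (p a : nat) : prime p -> tau (p ^ a) = a.+1.
Proof.
move=> p_pr; rewrite /tau -[RHS](size_iota 0) -[RHS](size_map (expn p)).
apply/perm_size/uniq_perm; first exact: divisors_uniq.
  rewrite map_inj_uniq ?iota_uniq //; exact/expnI/prime_gt1.
move=> d; rewrite -dvdn_divisors ?expn_gt0 ?prime_gt0 //.
apply/(dvdn_pfactor _ _ p_pr)/mapP => [[k le_ka ->] | [k]].
  by exists k; rewrite // mem_iota.
by rewrite mem_iota => /= lt_ka ->; exists k.
Qed.

Lemma omegaM (a b : nat) : (0 < a)%N -> (0 < b)%N -> coprime a b ->
  omega (a * b) = (omega a + omega b)%N.
Proof.
move=> a_gt0 b_gt0 co_ab; rewrite /omega -size_cat.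
apply/perm_size/uniq_perm; rewrite ?primes_uniq //.
  by rewrite cat_uniq !primes_uniq -coprime_has_primes // co_ab.
by move=> p; rewrite mem_cat primesM.
Qed.

Lemma omega_pfactor (p a : nat) : prime p -> (0 < a)%N -> omega (p ^ a) = 1%N.
Proof. by move=> p_pr a_gt0; rewrite /omega primesX // primes_prime. Qed.

(** * From prime powers to all integers *)

Lemma mult_energy_pfactor_gt (s p a : nat) : prime p -> (0 < s)%N ->
  (tau (p ^ a))%:R ^+ (2 * s).+1 *
    ((eulerian (2 * s).+1 s)%:~R / ((2 * s).+1)`!%:R) <
  (mult_energy s.+1 (p ^ a))%:R :> rat.
Proof.
move=> p_pr s_gt0; rewrite mult_energy_coef // tau_pfactor //.
exact: central_geom_gt.
Qed.

Lemma mult_energy_pfactor_le (s p a : nat) : prime p -> (0 < a)%N ->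
  (mult_energy s.+1 (p ^ a))%:R <=
  (tau (p ^ a))%:R ^+ (2 * s).+1 *
    ('C(2 * s.+1, s.+1)%:R / 2 ^+ (2 * s).+1) :> rat.
Proof.
move=> p_pr a_gt0; rewrite mult_energy_coef // tau_pfactor //.
exact: central_geom_le.
Qed.

(** Strip from n the full power of its smallest prime factor; the cofactor is coprime to it and
    smaller than n. *)
Lemma pfactor_coprime_ind (P : nat -> Prop) :
  P 1%N ->
  (forall p a m, prime p -> (0 < a)%N -> (0 < m)%N -> coprime (p ^ a) m ->
     P m -> P (p ^ a * m)%N) ->
  forall n, (0 < n)%N -> P n.
Proof.
move=> P1 PM n; have [k] := ubnP n; elim: k n => // k IHk n lt_nk n_gt0.
have [->|n_gt1] : n = 1%N \/ (1 < n)%N by lia.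
  by [].
have p_pr := pdiv_prime n_gt1; set p := pdiv n in p_pr.
have [m co_pm def_n] := pfactor_coprime p_pr n_gt0.
have log_gt0 : (0 < logn p n)%N.
  by rewrite logn_gt0 mem_primes p_pr n_gt0 pdiv_dvd.
have m_gt0 : (0 < m)%N by move: n_gt0; rewrite def_n muln_gt0 => /andP[].
rewrite def_n mulnC; apply: PM => //; first by rewrite coprimeXl.
apply: IHk => //; rewrite ltnS in lt_nk; apply: leq_trans lt_nk.
rewrite [in leqRHS]def_n.
by rewrite ltn_Pmulr // -(exp1n (logn p n)) ltn_exp2r // prime_gt1.
Qed.

Lemma mult_energy1 (s : nat) : mult_energy s 1 = 1%N.
Proof.
apply: (mulrIn (oner_neq0 rat)); rewrite -(expn0 2) mult_energy_coef //.
by rewrite big_ord1 expr0 expr1n muln0 coef1.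
Qed.

(** Common multiplicative shape of the two bounds. *)
Definition tau_omega (k : nat) (c : rat) (n : nat) : rat :=
  (tau n)%:R ^+ k * c ^+ omega n.

Lemma tau_omega1 (k : nat) (c : rat) : tau_omega k c 1 = 1.
Proof. by rewrite /tau_omega expr0 mulr1 expr1n. Qed.

Lemma tau_omegaM (k : nat) (c : rat) (a b : nat) :
  (0 < a)%N -> (0 < b)%N -> coprime a b ->
  tau_omega k c (a * b) = tau_omega k c a * tau_omega k c b.
Proof.
move=> a_gt0 b_gt0 co_ab.
by rewrite /tau_omega tauM // omegaM // natrM exprMn exprD mulrACA.
Qed.

Lemma tau_omega_pfactor (k : nat) (c : rat) (p a : nat) :
  prime p -> (0 < a)%N ->
  tau_omega k c (p ^ a) = (tau (p ^ a))%:R ^+ k * c.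
Proof. by move=> p_pr a_gt0; rewrite /tau_omega omega_pfactor ?expr1. Qed.

Lemma tau_omega_gt0 (k : nat) (c : rat) (n : nat) :
  (0 < n)%N -> 0 < c -> 0 < tau_omega k c n.
Proof.
move=> n_gt0 c_gt0; rewrite mulr_gt0 ?exprn_gt0 // ltr0n /tau.
by have := divisor1 n; case: (divisors n).
Qed.

Lemma mult_energy_gt (s n : nat) : (0 < s)%N -> (1 < n)%N ->
  tau_omega (2 * s).+1 ((eulerian (2 * s).+1 s)%:~R / ((2 * s).+1)`!%:R) n
  < (mult_energy s.+1 n)%:R.
Proof.
move=> s_gt0 n_gt1; set c := _ / _.
have c_gt0 : 0 < c by rewrite divr_gt0 ?eulerian_gt0 ?ltr0n ?fact_gt0.
(* Equality holds at n = 1, and the cofactor may be 1, so the induction carries the weak bound too;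
   one strict prime power factor makes the product strict. *)
suff [_ ->//] : tau_omega (2 * s).+1 c n <= (mult_energy s.+1 n)%:R /\
  ((1 < n)%N -> tau_omega (2 * s).+1 c n < (mult_energy s.+1 n)%:R).
move: n {n_gt1}(ltnW n_gt1).
apply: pfactor_coprime_ind => [|p a m p_pr a_gt0 m_gt0 co_pm [IHm _]].
  by rewrite tau_omega1 mult_energy1.
suff lt_pm : tau_omega (2 * s).+1 c (p ^ a * m)
    < (mult_energy s.+1 (p ^ a * m))%:R by split=> // ; rewrite ltW.
have pa_gt0 : (0 < p ^ a)%N by rewrite expn_gt0 prime_gt0.
rewrite tau_omegaM // mult_energyM // natrM tau_omega_pfactor //.
have lt_pa := mult_energy_pfactor_gt a p_pr s_gt0.
apply: lt_le_trans (ler_wpM2l (ler0n _ _) IHm).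
by rewrite ltr_pM2r // tau_omega_gt0.
Qed.

Lemma mult_energy_le (s n : nat) : (0 < n)%N ->
  (mult_energy s.+1 n)%:R <=
  tau_omega (2 * s).+1 ('C(2 * s.+1, s.+1)%:R / 2 ^+ (2 * s).+1) n.
Proof.
move: n; apply: pfactor_coprime_ind => [|p a m p_pr a_gt0 m_gt0 co_pm IHm].
  by rewrite tau_omega1 mult_energy1.
have pa_gt0 : (0 < p ^ a)%N by rewrite expn_gt0 prime_gt0.
rewrite tau_omegaM // mult_energyM // natrM tau_omega_pfactor //.
by rewrite ler_pM // mult_energy_pfactor_le.
Qed.

Theorem theorem1p4 (s n : nat) (hs : (2 <= s)%N) (hn : (2 <= n)%N) :
  ((tau n)%:R ^+ (2 * s - 1) *
     ((eulerian (2 * s - 1) (s - 1))%:~R / ((2 * s - 1)`!)%:R) ^+ omega n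
   < (mult_energy s n)%:R :> rat) /\
  ((mult_energy s n)%:R
   <= (tau n)%:R ^+ (2 * s - 1) *
        ('C(2 * s, s)%:R / 2 ^+ (2 * s - 1)) ^+ omega n :> rat).
Proof.
case: s hs => // s; rewrite ltnS => s_gt0.
have -> : (2 * s.+1 - 1 = (2 * s).+1)%N by lia.
rewrite subn1; split; first exact: mult_energy_gt.
by apply: mult_energy_le; apply: ltnW.
Qed.
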